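(* Consider the reduced threshold game described in the context. It has a unique Nash equilibrium $(\underline\theta^{i*})_{1\le i\le n}$, $\underline\theta^{i*}=(\theta_1^{i*},\dots,\theta_M^{i*})$, which is given as follows: for each agent $i$, the thresholds $\theta^{i*}_2,\dots,\theta_M^{i*}$ for the second lock onwards are those defined by the backward recursion in the context, and the first-lock thresholds $\theta^{1*}_1,\dots,\theta^{n*}_1$ simultaneously satisfy, for all $1\le i\le n$, $$\theta_1^{i*}=\inf\Big\{t:\ \big(\Upsilon_2^{i*}(t)+c^i_1\big)\,e^{-\sum_{m\ne i}\beta^m\,(t\wedge\theta_1^{m*})}\le\nu\Big\}\wedge T .$$
   Context: Data: number of agents $n$, number of locks $M\ge1$, deadline $T>0$, trade-off factor $\nu>0$, maximal rates $\beta^i>0$, and rewards $c_k^i$ ($1\le i\le n$, $1\le k\le M$). Notation: $x\wedge y=\min\{x,y\}$. Reduced game: players $\{1,\dots,n\}$; the strategy set of player $i$ is $[0,T]^M\ni\underline\theta^i=(\theta^i_1,\dots,\theta^i_M)$. Here $\theta^i_k$ is the time until which player $i$ attempts lock $k$, at rate $\beta^i$, provided all previous locks were acquired successfully and the previous lock was acquired before $\theta^i_k$; otherwise lock $k$ is not attempted. The utility of player $i$ is $\phi^i=\sum_{k=1}^ME[r^i_k]$, where $\tau_0=0$ and, given that locks $1,\dots,k-1$ were successfully acquired with lock $k-1$ acquired at time $\tau_{k-1}<\theta^i_k$, $$r^i_k=\int_{\tau_{k-1}}^{\theta^i_k}\big(c^i_k\eta^i_k(s)-\nu\big)\beta^ie^{-\beta^i(s-\tau_{k-1})}\,ds,\qquad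 \eta^i_1(s)=e^{-\sum_{m\neq i}\beta^m(s\wedge\theta^m_1)},\quad \eta^i_k\equiv1\ (k>1),$$ and $r^i_k=0$ otherwise. In the former case the contact time $\tau_k$ has density $\beta^ie^{-\beta^i(s-\tau_{k-1})}$ on $(\tau_{k-1},\theta_k^i)$ (with the remaining probability there is no contact with lock $k$), and a contact at time $s$ is successful with probability $\eta^i_k(s)$; after no contact or an unsuccessful contact the player stops. Recursion for locks $k\ge2$: for $t\in[0,T]$, $\theta_M^{i*}=T\mathbf 1_{\{c^i_M>\nu\}}$ and $\Upsilon_M^{i*}(t)=(c^i_M-\nu)(1-e^{-\beta^i(T-t)})\mathbf 1_{\{c^i_M>\nu\}}$; for $2\le k<M$, $\theta_k^{i*}=\inf\{t\in[0,T]:c^i_k+\Upsilon_{k+1}^{i*}(t)\le\nu\}$ with $\inf\emptyset:=T$, and $\Upsilon_k^{i*}(t)=\mathbf 1_{\{t<\theta_k^{i*}\}}\int_t^{\theta_k^{i*}}(c^i_k+\Upsilon^{i*}_{k+1}(s)-\nu)\beta^ie^{-\beta^i(s-t)}\,ds$. When $M=1$ there is no recursion and $\Upsilon_2^{i*}\equiv0$. In the equation for $\theta_1^{i*}$ the infimum is over $t\in[0,T]$, and an empty infimum gives $\theta_1^{i*}=T$.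
   Formalization: Uniqueness of the Nash equilibrium is proved when all locks are reached and no agent is exactly indifferent after its threshold; otherwise (e.g. M=n=1, c=ν) it fails, and equilibria are shown to agree with θ* up to unreached locks and indifference. *)

(* Defs.v *)
From HB Require Import structures.
From mathcomp Require Import all_boot all_order all_algebra.
From mathcomp Require Import all_classical all_reals all_analysis.

Set Implicit Arguments.
Unset Strict Implicit.
Unset Printing Implicit Defensive.

Import Order.TTheory GRing.Theory Num.Theory.
Import numFieldNormedType.Exports.

Local Open Scope classical_set_scope.
Local Open Scope ring_scope.

Section LockGame.
Context {R : realType} {n M : nat}.

(* There are M.+1 locks, numbered from 0: ord0 is the first lock (the only one
   contested by the other agents) and ord_max is the last one. *)
Definition strategy := 'I_M.+1 -> R.
Definition profile := 'I_n -> strategy.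

Variables (T nu : R) (beta : 'I_n -> R) (c : 'I_n -> 'I_M.+1 -> R).
Implicit Types (theta : profile) (sigma : strategy) (i : 'I_n) (k : 'I_M.+1).

Definition admissible sigma := forall k, 0 <= sigma k <= T.

(* The reduced game *)

Definition contact_density i (t s : R) : R :=
  beta i * expR (- beta i * (s - t)).

Definition eta theta i k (s : R) : R :=
  if k == ord0
  then expR (- \sum_(m < n | m != i) beta m * Num.min s (theta m ord0))
  else 1.

(* r^i_k, given that all the previous locks were acquired, the last of them at
   time t (t = 0 for the first lock). *)
Definition reward theta i k (t : R) : R :=
  if t < theta i k then
    \int[lebesgue_measure]_(s in `[t, theta i k])
      ((c i k * eta theta i k s - nu) * contact_density i t s)
  else 0.

(* E[f(tau_k); lock k is acquired], given as in [reward] that lock k can be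
   attempted from time t on. *)
Definition acquire theta i k (f : R -> R) (t : R) : R :=
  if t < theta i k then
    \int[lebesgue_measure]_(s in `[t, theta i k])
      (f s * eta theta i k s * contact_density i t s)
  else 0.

(* E[r^i_k], by conditioning successively on the acquisition times of the locks
   0, ..., k-1: it is
     acquire 0 (acquire 1 (... (acquire (k-1) (reward k)))) 0. *)
Definition expected_reward theta i k : R :=
  foldr (fun j : nat => acquire theta i (inord j)) (reward theta i k)
        (iota 0 k) 0.

Definition utility theta i : R := \sum_(k < M.+1) expected_reward theta i k.

Definition nash theta : Prop :=
  (forall i, admissible (theta i)) /\
  (forall i sigma, admissible sigma ->
     utility [eta theta with i |-> sigma] i <= utility theta i).

(* The backward recursion *)

Definition inf_or_deadline (A : set R) : R := if A == set0 then T else inf A.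

Definition stopping_threshold (r : R) (U : R -> R) : R :=
  inf_or_deadline [set t | 0 <= t <= T /\ r + U t <= nu].

(* [Upsilon_rec i j] and [threshold_rec i j] are the value function and the
   threshold of the lock that is followed by exactly j further locks. *)
Fixpoint Upsilon_rec i (j : nat) : R -> R :=
  if j is j'.+1 then
    let r := c i (inord (M - j)) in
    let U := Upsilon_rec i j' in
    let th := stopping_threshold r U in
    fun t => if t < th then
        \int[lebesgue_measure]_(s in `[t, th])
          ((r + U s - nu) * contact_density i t s)
      else 0
  else fun t =>
    if nu < c i ord_max
    then (c i ord_max - nu) * (1 - expR (- beta i * (T - t))) else 0.

Definition threshold_rec i (j : nat) : R :=
  if j is j'.+1
  then stopping_threshold (c i (inord (M - j))) (Upsilon_rec i j')
  else if nu < c i ord_max then T else 0.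

Definition later_threshold i k : R := threshold_rec i (M - k).

(* The value function of the lock that follows k (0 if k is the last lock). *)
Definition Upsilon_next i k (t : R) : R :=
  if (k < M)%N then Upsilon_rec i (M - k.+1) t else 0.

Definition equilibrium_equations theta : Prop :=
  (forall i k, k != ord0 -> theta i k = later_threshold i k) /\
  (forall i, theta i ord0 =
     Num.min
       (inf_or_deadline
          [set t | 0 <= t <= T /\
             (Upsilon_next i ord0 t + c i ord0) *
             expR (- \sum_(m < n | m != i) beta m * Num.min t (theta m ord0))
             <= nu])
       T).

(* The uniqueness of the equilibrium *)

(* The net gain of agent i per contact with lock k at time s, if later locks
   are attempted optimally. *)
Definition net_gain theta i k (s : R) : R :=
  (c i k + Upsilon_next i k s) * eta theta i k s - nu.

(* Lock k is reached with positive probability.  Otherwise the threshold of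
   agent i for lock k has no influence on any utility. *)
Definition reachable theta i k : Prop :=
  forall j : 'I_M.+1, (j < k)%N -> 0 < theta i j.

(* theta coincides with theta0 up to the two phenomena that leave a threshold
   undetermined: a lock that is never reached, and an agent that is exactly
   indifferent between stopping at theta0 i k and at any time up to
   theta i k. *)
Definition agree_up_to_indifference theta0 theta : Prop :=
  forall i k, reachable theta i k ->
    theta0 i k <= theta i k /\
    (forall s, theta0 i k <= s < theta i k -> net_gain theta i k s = 0).

(* Neither of the two phenomena occurs at theta: all locks are reached, and no
   agent is indifferent at a time after its threshold. *)
Definition generic_profile theta : Prop :=
  (forall i k, reachable theta i k) /\
  (forall i k s, theta i k < s < T -> net_gain theta i k s != 0).

End LockGame.

(* Main.v *)
Require Import Defs.
From mathcomp Require Import all_boot all_order all_algebra.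
From mathcomp Require Import all_classical all_reals all_analysis.
From mathcomp Require Import ring lra.
Import Order.TTheory GRing.Theory Num.Theory.
Import numFieldNormedType.Exports.
Local Open Scope classical_set_scope.
Local Open Scope ring_scope.

(* Every reward is a value int_t^th f(s) b e^(-b(s-t)) ds = e^(bt) (P th - P t),
   where P is a primitive of f(s) b e^(-bs); against a fixed choice of the other
   agents, stopping lock k is optimal exactly where the net gain (with optimal
   continuation) changes sign, which it does once.  Equality in the resulting
   bound on the utility forces, lock by lock along t = 0, the net gain to vanish
   between the optimal and the chosen threshold.

   The net gain of the first lock at time t depends on the others only through
   their thresholds truncated at t.  Hence the first-lock equations can be solved
   in order of stopping times, and two solutions agree up to the first time at
   which they could differ, so everywhere.  At a Nash equilibrium an agent who
   continues while indifferent is the last one active, so replacing thresholds by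
   best responses changes no best response and yields the solution of the
   equations. *)

(** * Primitives of continuous functions on the line *)

Section Primitive.
Context {R : realType}.
Implicit Types (f g P Q : R -> R) (a b x y : R).

Definition primitive f P := forall x, is_derive x (1 : R) P (f x).

Lemma primitive_continuous {f P} : primitive f P -> continuous P.
Proof.
move=> fP x; apply/differentiable_continuous; rewrite -derivable1_diffP.
by case: (fP x).
Qed.

Lemma continuous_integrable {f} a b : continuous f ->
  lebesgue_measure.-integrable `[a, b] (EFin \o f).
Proof.
move=> cf; apply: continuous_compact_integrable; first exact: segment_compact.
exact: continuous_subspaceT.
Qed.

(** An integral from a base point needs that point to lie to the left. The base point is therefore
    allowed to move with [x], and subtracting the integral up to 0 makes the result independent of
    it. *)
Lemma primitive_exists {f} : continuous f -> exists P, primitive f P.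
Proof.
move=> cf.
pose I a x := \int[lebesgue_measure]_(s in `[a, x]) f s.
have II a a' x y : a <= a' -> a' <= x -> a' <= y ->
    I a x - I a y = I a' x - I a' y.
  move=> aa'; have E z : a' <= z -> I a z = I a a' + I a' z.
    move=> a'z; rewrite [I a' z]/I -Rintegral_itv_obnd_cbnd; last first.
      apply: integrableS (continuous_integrable a' z cf) => //.
      exact: subset_itv_oc_cc.
    rewrite -(@Rintegral_itvB _ _ (BLeft a)) ?bnd_simp//;
      last exact: continuous_integrable.
    by rewrite addrC subrK.
  by move=> /E -> /E ->; ring.
pose P x := I (- (`|x| + 1)) x - I (- (`|x| + 1)) 0.
(* This [a] lies below the base point used for every [y] within distance 1 of [x], so near [x] the
   function [P] is an integral from a fixed point. *)
exists P => x; set a := - (`|x| + 2).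
apply: (@near_eq_is_derive _ _ _ (fun y => I a y - I a 0)).
  near=> y.
  have : `|x - y| < 1 by near: y; exact: (nbhsx_ballx x 1 ltr01).
  move=> xy; apply: II; rewrite /a.
  - have : `|y| <= `|x| + `|x - y| by rewrite -{1}(subKr x y) ler_normB.
    by lra.
  - have := ler_norm (- y); rewrite normrN; lra.
  - have := normr_ge0 y; lra.
have ax : a < x by rewrite /a; have := ler_norm (- x); rewrite normrN; lra.
have x1 : x < x + 1 by rewrite ltrDl.
have [dI <-] := continuous_FTC1_closed x1 (continuous_integrable a (x + 1) cf) ax (cf x).
rewrite derive1E -[X in is_derive _ _ _ X]subr0.
by apply: is_deriveB; exact: derivableP.
Unshelve. all: by end_near.
Qed.

Lemma Rintegral_primitive {f P a b} : continuous f -> primitive f P -> a < b ->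
  \int[lebesgue_measure]_(s in `[a, b]) f s = P b - P a.
Proof.
move=> cf fP ab; rewrite /Rintegral (continuous_FTC2 (F := P) ab) //.
- exact: continuous_subspaceT.
- split; first by move=> x _; case: (fP x).
  + apply: cvg_at_right_filter; exact: (primitive_continuous fP).
  + apply: cvg_at_left_filter; exact: (primitive_continuous fP).
- by move=> x _; rewrite derive1E; case: (fP x).
Qed.

Lemma primitive_mean_value {f P a b} : primitive f P -> a < b ->
  exists2 x, a < x < b & P b - P a = f x * (b - a).
Proof.
move=> fP ab; have [|c cab E] := MVT ab (fun x _ => fP x); last by exists c.
exact: continuous_subspaceT (primitive_continuous fP).
Qed.

Lemma primitive_le {f P a b} : primitive f P -> a <= b ->
  (forall x, a < x < b -> 0 <= f x) -> P a <= P b.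
Proof.
move=> fP; rewrite le_eqVlt => /predU1P[->//|ab] f0.
have [x xab E] := primitive_mean_value fP ab.
by rewrite -subr_ge0 E mulr_ge0 ?f0 ?subr_ge0 ?ltW.
Qed.

Lemma primitive_lt {f P a b} : primitive f P -> a < b ->
  (forall x, a < x < b -> 0 < f x) -> P a < P b.
Proof.
move=> fP ab f0; have [x xab E] := primitive_mean_value fP ab.
by rewrite -subr_gt0 E mulr_gt0 ?f0 ?subr_gt0.
Qed.

Lemma primitiveN {f P} : primitive f P -> primitive (- f) (- P).
Proof. by move=> fP x; apply: is_deriveN; exact: fP. Qed.

Lemma primitiveD {f P g Q} :
  primitive f P -> primitive g Q -> primitive (f + g) (P + Q).
Proof. by move=> fP gQ x; apply: is_deriveD; [exact: fP|exact: gQ]. Qed.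

Lemma primitiveB {f P g Q} :
  primitive f P -> primitive g Q -> primitive (f - g) (P - Q).
Proof. by move=> fP gQ; exact: primitiveD (primitiveN gQ). Qed.

(** [P] is nondecreasing with equal end values, hence flat. If [f x] were nonzero, [f] would be
    nonzero just to the right of [x] by continuity, against the mean value theorem there. *)
Lemma primitive_eq0 {f P a b} : continuous f -> primitive f P -> a < b ->
  (forall x, a < x < b -> 0 <= f x) -> P a = P b ->
  forall x, a <= x < b -> f x = 0.
Proof.
move=> cf fP ab f0 Pab x /andP[ax xb].
have mono y z : a <= y -> y <= z -> z <= b -> P y <= P z.
  move=> ay yz zb; apply: primitive_le fP yz _ => u /andP[yu uz]; apply: f0.
  by rewrite (le_lt_trans ay yu) (lt_le_trans uz zb).
have flat z : a <= z -> z <= b -> P z = P a.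
  move=> az zb; apply/eqP; rewrite eq_le {1}Pab.
  by rewrite (mono z b) ?lexx// (mono a z) ?lexx.
apply/eqP/negPn/negP => fx0.
have [e e0 fe] : exists2 e, 0 < e & forall y, `|x - y| < e -> f y != 0.
  have : \forall y \near x, f y != 0 by apply: (cvgr_neq0 _ (cf x)).
  by move=> /nbhs_ballP[e e0 fe]; exists e => // y xy; exact: fe.
pose d := Num.min e (b - x).
have d0 : 0 < d by rewrite lt_min e0 subr_gt0.
have de : d <= e by rewrite ge_min lexx.
have dbx : d <= b - x by rewrite ge_min lexx orbT.
have xd : x < x + d by rewrite ltrDl.
have [y /andP[xy yxd] /eqP] := primitive_mean_value fP xd.
rewrite !flat//; last 3 first.
- exact: ltW.
- lra.
- lra.
rewrite subrr eq_sym mulf_eq0 (negbTE (fe _ _)) /=; first lra.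
by rewrite distrC gtr0_norm; lra.
Qed.
End Primitive.

(** * The value of attempting a lock until a fixed time *)

Section StopValue.
Context {R : realType}.
Variable b : R.
Hypothesis b_gt0 : 0 < b.
Implicit Types (f g F G P Q : R -> R) (s t u v sigma th T : R).

(* The value, at time t, of attempting until sigma a lock whose contact at
   time s is worth f s. *)
Definition stop_value sigma f t : R :=
  if t < sigma then
    \int[lebesgue_measure]_(s in `[t, sigma]) (f s * (b * expR (- b * (s - t))))
  else 0.

(** The factor e^(bt) of the contact density is split off, so that one primitive serves all starting
    times [t]. *)
Definition discounted f s : R := f s * (b * expR (- b * s)).

Lemma discount_gt0 s : 0 < b * expR (- b * s).
Proof. by rewrite mulr_gt0 ?expR_gt0. Qed.

Lemma continuous_discounted f : continuous f -> continuous (discounted f).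
Proof.
move=> cf x; apply: cvgM; first exact: cf.
apply: cvgM; first exact: cvg_cst.
apply: (continuous_comp (f := fun s => - b * s)); last exact: continuous_expR.
exact: mulrl_continuous.
Qed.

Lemma discounted_primitive_exists {f} : continuous f ->
  exists P, primitive (discounted f) P.
Proof. by move=> cf; apply/primitive_exists/continuous_discounted. Qed.

Lemma discounted_cst_primitive k :
  primitive (discounted (fun=> k)) (fun s => - k * expR (- b * s)).
Proof.
move=> s; rewrite /discounted.
have -> : k * (b * expR (- b * s)) = - k * (- b * expR (- b * s)) by ring.
apply: is_deriveZ.
have dl : is_derive s (1 : R) (fun s => - b * s) (- b).
  rewrite -[X in is_derive _ _ _ X]mulr1.
  by apply: is_deriveZ; exact: is_derive_id.
have := is_derive1_comp (f := expR) (g := fun s => - b * s) (x := s).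
by rewrite [- b * expR _]mulrC; apply; exact: is_derive_expR.
Qed.

(** The minimum merges both branches of [stop_value]: for [t] past [sigma] the difference is 0.
    Continuity in [t] can then be read off. *)
Lemma stop_valueE {f P sigma t} : continuous f -> primitive (discounted f) P ->
  stop_value sigma f t = expR (b * t) * (P sigma - P (Num.min t sigma)).
Proof.
move=> cf fP; rewrite /stop_value.
case: ltP => [ts|]; last by rewrite subrr mulr0.
have fPt : primitive (fun s => expR (b * t) * discounted f s)
    (fun s => expR (b * t) * P s).
  by move=> s; apply: is_deriveZ; exact: fP.
have cft : continuous (fun s => expR (b * t) * discounted f s).
  by move=> s; apply: cvgM; [exact: cvg_cst|exact: continuous_discounted].
rewrite mulrBr -(Rintegral_primitive cft fPt ts).
apply: eq_Rintegral => s _; rewrite /discounted.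
have -> : - b * (s - t) = b * t + (- b * s) by ring.
by rewrite expRD; ring.
Qed.

Lemma stop_value_continuous f sigma : continuous f ->
  continuous (stop_value sigma f).
Proof.
move=> cf; have [P fP] := discounted_primitive_exists cf.
have -> : stop_value sigma f =
    (fun t => expR (b * t) * (P sigma - P (Num.min t sigma))).
  by apply/funext => t; exact: stop_valueE.
move=> t; apply: cvgM.
  apply: (continuous_comp (f := fun s => b * s)); last exact: continuous_expR.
  exact: mulrl_continuous.
apply: cvgB; first exact: cvg_cst.
apply: (continuous_comp (f := fun t => Num.min t sigma) (g := P)).
  by apply: continuous_min; [exact: cvg_id|exact: cvg_cst].
exact: primitive_continuous fP _.
Qed.

Lemma stop_valueD f g sigma t : continuous f -> continuous g ->
  stop_value sigma (fun s => f s + g s) t =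
  stop_value sigma f t + stop_value sigma g t.
Proof.
move=> cf cg; have [P fP] := discounted_primitive_exists cf.
have [Q gQ] := discounted_primitive_exists cg.
have cfg : continuous (fun s => f s + g s).
  by move=> s; apply: cvgD; [exact: cf|exact: cg].
have fgPQ : primitive (discounted (fun s => f s + g s)) (P + Q).
  have -> : discounted (fun s => f s + g s) = discounted f + discounted g.
    by apply/funext => s; rewrite /discounted mulrDl.
  exact: primitiveD.
rewrite (stop_valueE cf fP) (stop_valueE cg gQ) (stop_valueE cfg fgPQ) /=.
by rewrite !fctE; ring.
Qed.

Lemma eq_stop_value f g sigma t :
  (forall s, t <= s <= sigma -> f s = g s) ->
  stop_value sigma f t = stop_value sigma g t.
Proof.
move=> fg; rewrite /stop_value; case: ifP => // _; apply: eq_Rintegral => s.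
by rewrite inE /= in_itv /= => /fg ->.
Qed.

Lemma stop_value0 sigma t : stop_value sigma (fun=> 0) t = 0.
Proof.
rewrite (stop_valueE _ (@discounted_cst_primitive 0)); last exact: cst_continuous.
by rewrite !oppr0 !mul0r subrr mulr0.
Qed.

Lemma continuous_ord_sum l (F : nat -> R -> R) :
  (forall k, continuous (F k)) -> continuous (fun s => \sum_(k < l) F k s).
Proof. by move=> cF s; apply: cvg_big => [|k _]; [exact: add_continuous|exact: cF]. Qed.

Lemma stop_value_sum l (F : nat -> R -> R) sigma t :
  (forall k, continuous (F k)) ->
  stop_value sigma (fun s => \sum_(k < l) F k s) t =
  \sum_(k < l) stop_value sigma (F k) t.
Proof.
move=> cF; elim: l => [|l IH].
  rewrite big_ord0 -[RHS](stop_value0 sigma t).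
  by apply: eq_stop_value => s _; rewrite big_ord0.
rewrite big_ord_recr /= -IH -stop_valueD//; last exact: continuous_ord_sum.
by apply: eq_stop_value => s _; rewrite big_ord_recr.
Qed.

Lemma le_stop_value f g sigma t : continuous f -> continuous g ->
  (forall s, t < s < sigma -> f s <= g s) ->
  stop_value sigma f t <= stop_value sigma g t.
Proof.
move=> cf cg fg; have [P fP] := discounted_primitive_exists cf.
have [Q gQ] := discounted_primitive_exists cg.
rewrite (stop_valueE cf fP) (stop_valueE cg gQ) ler_pM2l ?expR_gt0//.
have [ts|st] := ltP t sigma; last by rewrite !subrr.
rewrite -subr_ge0.
have -> : Q sigma - Q t - (P sigma - P t) = (Q - P) sigma - (Q - P) t.
  by rewrite !fctE; ring.
rewrite subr_ge0; apply: primitive_le (primitiveB gQ fP) (ltW ts) _ => s /fg fgs.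
by rewrite !fctE subr_ge0 ler_pM2r ?discount_gt0.
Qed.

Lemma stop_value_ge0 f sigma t : continuous f ->
  (forall s, t < s < sigma -> 0 <= f s) -> 0 <= stop_value sigma f t.
Proof.
move=> cf f0; rewrite -(stop_value0 sigma t).
by apply: le_stop_value; first exact: cst_continuous.
Qed.

(** The worth is at least [f t] between [s] and [t] and at most [f t] from [t] to [th]. Put x =
    e^(bs) and y = e^(bt). It suffices that (y - x) (P th - P t) <= x (P t - P s), and (y - x) f(t)
    / y lies between the two sides. *)
Lemma stop_value_anti f th s t : continuous f -> 0 <= s -> s <= t ->
  (forall u v, 0 <= u -> u <= v -> v <= th -> f v <= f u) ->
  (forall u, 0 <= u < th -> 0 <= f u) ->
  stop_value th f t <= stop_value th f s.
Proof.
move=> cf s0 st f_anti f_ge0; have [P fP] := discounted_primitive_exists cf.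
have [tht|tth] := leP th t.
  rewrite {1}/stop_value ltNge tht /=; apply: stop_value_ge0 => // u /andP[su uth].
  by apply: f_ge0; rewrite uth andbT ltW// (le_lt_trans s0 su).
have t0 : 0 <= t by exact: le_trans st.
move: st; rewrite le_eqVlt => /predU1P[->//|st].
rewrite !(stop_valueE cf fP) (min_idPl (ltW tth)) (min_idPl (ltW (lt_trans st tth))).
have ft0 : 0 <= f t by rewrite f_ge0 ?t0.
have upper : P th - P t <= f t * expR (- b * t).
  have := primitive_le (primitiveB (discounted_cst_primitive (f t)) fP) (ltW tth).
  rewrite !fctE => /(_ _)/wrap[u /andP[tu uth]|].
    by rewrite subr_ge0 /discounted /= ler_pM2r ?discount_gt0// f_anti// ltW.
  by have := mulr_ge0 ft0 (expR_ge0 (- b * th)); lra.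
have lower : f t * (expR (- b * s) - expR (- b * t)) <= P t - P s.
  have := primitive_le (primitiveB fP (discounted_cst_primitive (f t))) (ltW st).
  rewrite !fctE => /(_ _)/wrap[u /andP[su ut]|]; last by lra.
  rewrite subr_ge0 /discounted /= ler_pM2r ?discount_gt0// f_anti//; apply/ltW => //.
  exact: le_lt_trans su.
have Es x : expR (- b * x) = (expR (b * x))^-1 by rewrite mulNr expRN.
rewrite !Es in upper lower.
set x := expR (b * s) in upper lower *; set y := expR (b * t) in upper lower *.
have x0 : 0 < x by exact: expR_gt0.
have xy : x <= y by rewrite ler_expR ler_pM2l// ltW.
have y0 : 0 < y by exact: expR_gt0.
have -> : x * (P th - P s) = x * (P th - P t) + x * (P t - P s) by ring.
rewrite -lerBlDl -mulrBl.
apply: (@le_trans _ _ (x * (f t * (x^-1 - y^-1)))); last by rewrite ler_pM2l.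
have -> : x * (f t * (x^-1 - y^-1)) = (y - x) * (f t * y^-1).
  by field; rewrite !gt_eqF.
by rewrite ler_wpM2l ?subr_ge0.
Qed.

(** The sign of [G] makes the discounted primitive rise up to [th] and fall afterwards, so it peaks
    at [th]. *)
Lemma stop_value_max G sigma th t T : continuous G -> 0 <= t -> sigma <= T ->
  (forall s, 0 <= s < th -> 0 < G s) -> (forall s, th <= s < T -> G s <= 0) ->
  stop_value sigma G t <= stop_value th G t.
Proof.
move=> cG t0 sT Gpos Gneg; have [P GP] := discounted_primitive_exists cG.
have up u v : 0 <= u -> u <= v -> v <= th -> P u <= P v.
  move=> u0 uv vth; apply: primitive_le GP uv _ => s /andP[us sv].
  apply: mulr_ge0; last exact: ltW (discount_gt0 _).
  by apply/ltW/Gpos; rewrite (le_trans u0 (ltW us)) (lt_le_trans sv vth).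
have down u v : th <= u -> u <= v -> v <= T -> P v <= P u.
  move=> thu uv vT; rewrite -lerN2; apply: primitive_le (primitiveN GP) uv _.
  move=> s /andP[us sv]; rewrite fctE oppr_ge0 pmulr_lle0 ?discount_gt0//.
  by apply: Gneg; rewrite (le_trans thu (ltW us)) (lt_le_trans sv vT).
rewrite !(stop_valueE cG GP) ler_pM2l ?expR_gt0//.
have [ts|st] := ltP t sigma; have [tth|tht] := ltP t th.
- rewrite lerD2r; have [sth|ths] := leP sigma th; last exact: down (ltW ths) _.
  by apply: up => //; exact: le_trans (ltW ts).
- by rewrite subrr subr_le0; apply: down => //; exact: ltW.
- by rewrite subrr subr_ge0; apply: up => //; exact: ltW.
- by rewrite !subrr.
Qed.

(** The value of [G] stopped at [sigma] is squeezed between the two equal values. Equality on the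
    [G] side forces [G] to vanish between [th] and [sigma]. Equality on the [F] side forces F = G
    before [sigma], recorded at 0 only. *)
Lemma stop_value_max_eq F G sigma th T :
  continuous F -> continuous G -> 0 <= sigma <= T -> 0 <= th <= T ->
  (forall s, 0 <= s < th -> 0 < G s) -> (forall s, th <= s < T -> G s <= 0) ->
  (forall s, 0 <= s < T -> F s <= G s) ->
  stop_value sigma F 0 = stop_value th G 0 ->
  [/\ th <= sigma, forall s, th <= s < sigma -> G s = 0 &
      0 < sigma -> F 0 = G 0].
Proof.
move=> cF cG /andP[s0 sT] /andP[th0 thT] Gpos Gneg FG E.
have [P FP] := discounted_primitive_exists cF.
have [Q GQ] := discounted_primitive_exists cG.
have FG' s : 0 < s < sigma -> F s <= G s.
  by case/andP=> ss ssig; apply: FG; rewrite (ltW ss) (lt_le_trans ssig sT).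
have E1 : stop_value sigma F 0 = stop_value sigma G 0.
  apply/eqP; rewrite eq_le le_stop_value //= E.
  exact: (stop_value_max _ _ _ _ T).
have E2 : Q sigma = Q th.
  move: E; rewrite E1 !(stop_valueE cG GQ) !min_l// mulr0 expR0 !mul1r.
  by move/addIr.
have thsig : th <= sigma.
  rewrite leNgt; apply/negP => sth.
  have := primitive_lt GQ sth; rewrite E2 ltxx => /(_ _)/wrap[] // s /andP[ss sth'].
  by rewrite mulr_gt0 ?discount_gt0// Gpos// sth' (le_trans s0 (ltW ss)).
have cdG : continuous (discounted G) by exact: continuous_discounted.
split=> // [s /andP[ths ssig]|sig0].
  have sth : th < sigma by exact: le_lt_trans ssig.
  have := primitive_eq0 _ (primitiveN GQ) sth => /(_ _ _ _ s)/wrap[].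
  - by move=> x; apply: cvgN; exact: cdG.
  - move=> u /andP[thu us]; rewrite fctE oppr_ge0 pmulr_lle0 ?discount_gt0//.
    by apply: Gneg; rewrite (ltW thu) (lt_le_trans us sT).
  - by congr (- _); rewrite E2.
  rewrite ths ssig => /(_ isT)/eqP.
  rewrite fctE oppr_eq0 mulf_eq0 (gt_eqF (discount_gt0 _)) orbF.
  by move/eqP.
have := primitive_eq0 _ (primitiveB GQ FP) sig0 => /(_ _ _ _ 0)/wrap[].
- by move=> x; apply: cvgB; exact: continuous_discounted.
- move=> u /FG'; rewrite !fctE -mulrBl => FGu.
  by rewrite mulr_ge0 ?subr_ge0// ltW// discount_gt0.
- move: E1; rewrite (stop_valueE cF FP) (stop_valueE cG GQ) !min_l//.
  by rewrite mulr0 expR0 !mul1r !fctE; lra.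
rewrite lexx sig0 => /(_ isT)/eqP.
rewrite !fctE -mulrBl mulf_eq0 (gt_eqF (discount_gt0 _)) orbF.
by rewrite subr_eq0 => /eqP.
Qed.

End StopValue.

(** * Thresholds as first sign changes *)

Section Threshold.
Context {R : realType}.
Variable T : R.
Hypothesis T_ge0 : 0 <= T.
Implicit Types (G H : R -> R) (s t a th : R).

(** An infimum-free form of the stopping rule. At [th = T] nothing is asked of [G T], because the
    deadline is also the value of an empty infimum. *)
Definition is_threshold G th :=
  [/\ 0 <= th <= T, forall t, 0 <= t < th -> 0 < G t & th < T -> G th <= 0].

(** Weaker than monotonicity, which the net gain of the first lock may lack: a negative gross reward
    times a falling success probability increases. *)
Definition stays_nonpositive G :=
  forall s t, 0 <= s -> s <= t -> t <= T -> G s <= 0 -> G t <= 0.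

(** If [th'] came before [a], then [H] would be nonpositive at a point where [G] is still positive.
    Only values before [a] are compared. *)
Lemma is_threshold_ge G H th th' a : (forall t, 0 <= t < a -> G t = H t) ->
  is_threshold G th -> is_threshold H th' -> a <= th -> a <= th'.
Proof.
move=> GH [/andP[_ thT] Gpos _] [/andP[th'0 _] _ Hth'] ath.
rewrite leNgt; apply/negP => th'a; have th'th := lt_le_trans th'a ath.
have := Hth' (lt_le_trans th'th thT); rewrite -GH ?th'0// leNgt.
by rewrite Gpos// th'0.
Qed.

Lemma is_threshold_unique {G th th'} :
  is_threshold G th -> is_threshold G th' -> th = th'.
Proof.
move=> Gth Gth'; apply/eqP; rewrite eq_le.
by rewrite (is_threshold_ge G G _ _ th _ Gth)// (is_threshold_ge G G _ _ th' _ Gth').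
Qed.

Lemma eq_is_threshold {G} H {th} : (forall t, 0 <= t <= th -> G t = H t) ->
  is_threshold G th -> is_threshold H th.
Proof.
move=> GH [/andP[th0 thT] Gpos Gth]; split; first by rewrite th0.
  by move=> t /andP[t0 tth]; rewrite -GH ?t0 ?ltW// Gpos// t0.
by rewrite -GH// th0 lexx.
Qed.

Lemma is_threshold_le0 {G th} s : stays_nonpositive G -> is_threshold G th ->
  th <= s < T -> G s <= 0.
Proof.
move=> Gneg [/andP[th0 _] _ Gth] /andP[ths sT].
by apply: Gneg th0 ths (ltW sT) (Gth (le_lt_trans ths sT)).
Qed.

Lemma is_threshold_inf G : continuous G ->
  is_threshold G (inf_or_deadline T [set t | 0 <= t <= T /\ G t <= 0]).
Proof.
move=> cG; rewrite /inf_or_deadline; set A := [set t | _].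
have lbA : lbound A 0 by move=> t [/andP[]].
case: ifPn => [/eqP A0|/set0P[a0 Aa0]].
  split; rewrite ?lexx ?T_ge0 ?ltxx// => t /andP[t0 tT].
  rewrite ltNge; apply/negP => Gt; have : A t by rewrite /A /= t0 ltW.
  by rewrite A0.
have hlbA : has_lbound A by exists 0.
have th0 : 0 <= inf A by apply: lb_le_inf => //; exists a0.
have thT : inf A <= T by apply: le_trans (ge_inf hlbA Aa0) _; case: Aa0 => /andP[].
split; first by rewrite th0.
  move=> t /andP[t0 tth]; rewrite ltNge; apply/negP => Gt.
  have At : A t by rewrite /A /= t0 (le_trans (ltW tth)).
  by have := ge_inf hlbA At; rewrite leNgt tth.
move=> _; rewrite leNgt; apply/negP => Gth.
have : \forall t \near inf A, 0 < G t by apply: (cvgr_gt _ (cG (inf A))).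
move=> /nbhs_ballP[e /= e0 Ge].
have [|t At te] := inf_adherent e0 (E := A); first by split=> //; exists a0.
have : 0 < G t.
  apply: Ge; rewrite /ball /= ler0_norm; last by rewrite subr_le0 ge_inf.
  by lra.
by rewrite ltNge; case: At => _ ->.
Qed.

Lemma is_thresholdP G th : continuous G ->
  is_threshold G th <-> th = inf_or_deadline T [set t | 0 <= t <= T /\ G t <= 0].
Proof.
move=> cG; split=> [Gth|->]; last exact: is_threshold_inf.
exact: is_threshold_unique Gth (is_threshold_inf _ cG).
Qed.

End Threshold.

(** * The backward recursion for the later locks *)

Section LockGame.
Context {R : realType} {n M : nat}.
Variables (T nu : R) (beta : 'I_n -> R) (c : 'I_n -> 'I_M.+1 -> R).
Hypotheses (T_gt0 : 0 < T) (nu_gt0 : 0 < nu) (beta_gt0 : forall i, 0 < beta i).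
Implicit Types (theta : @profile R n M) (sigma : @strategy R M).
Implicit Types (i : 'I_n) (k : 'I_M.+1) (s t : R).

Local Notation upsilon_rec := (Upsilon_rec T nu beta c).
Local Notation threshold_rec := (threshold_rec T nu beta c).
Local Notation upsilon_next := (Upsilon_next T nu beta c).
Local Notation net_gain := (net_gain T nu beta c).
Local Notation eta := (eta beta).

(** Treats the last lock, for which [Upsilon_rec] has a closed formula, like the others, with
    continuation value 0. *)
Definition rec_gain i j s : R :=
  c i (inord (M - j)) + (if j is j'.+1 then upsilon_rec i j' s else 0) - nu.

Let T_ge0 : 0 <= T. Proof. exact: ltW. Qed.

Definition rec_spec i j :=
  [/\ continuous (upsilon_rec i j),
      forall s t, 0 <= s -> s <= t -> t <= T ->
        upsilon_rec i j t <= upsilon_rec i j s,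
      is_threshold T (rec_gain i j) (threshold_rec i j) &
      forall t, 0 <= t <= T -> upsilon_rec i j t =
        stop_value (beta i) (threshold_rec i j) (rec_gain i j) t].

(** Backward induction over the locks: a continuous nonincreasing continuation value makes the gain
    continuous and nonincreasing, and the gain is positive before its threshold, so
    [stop_value_anti] passes both properties on to the preceding lock. *)
Lemma Upsilon_rec_spec i j : rec_spec i j.
Proof.
have b0 := beta_gt0 i.
have rec_gain0 : rec_gain i 0 = fun=> c i ord_max - nu.
  apply/funext => s; rewrite /rec_gain addr0 subn0; congr (c i _ - _).
  by apply/val_inj; rewrite /= inordK.
have cGS j' : continuous (upsilon_rec i j') -> continuous (rec_gain i j'.+1).
  move=> cU x; apply: cvgB; last exact: cvg_cst.
  by apply: cvgD; [exact: cvg_cst|exact: cU].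
have UE j' : upsilon_rec i j'.+1 =
    stop_value (beta i) (threshold_rec i j'.+1) (rec_gain i j'.+1) by [].
have spec j' : continuous (upsilon_rec i j') -> continuous (rec_gain i j') ->
    (forall s t, 0 <= s -> s <= t -> t <= T -> rec_gain i j' t <= rec_gain i j' s) ->
    is_threshold T (rec_gain i j') (threshold_rec i j') ->
    (forall t, 0 <= t <= T -> upsilon_rec i j' t =
        stop_value (beta i) (threshold_rec i j') (rec_gain i j') t) ->
  rec_spec i j'.
  move=> cU cG Ganti Gth U_E; split => // s t s0 st tT.
  rewrite !U_E ?tT ?s0 ?(le_trans s0 st) ?(le_trans st tT)//.
  have [/andP[th0 thT] Gpos _] := Gth.
  apply: stop_value_anti => //.
  - by move=> u v u0 uv vth; apply: Ganti => //; exact: le_trans vth thT.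
  - by move=> u /Gpos/ltW.
elim: j => [|j [cU Uanti _ _]]; apply: spec.
- case cnu: (nu < c i ord_max); rewrite /= cnu; last exact: cst_continuous.
  move=> x; apply: cvgM; first exact: cvg_cst.
  apply: cvgB; first exact: cvg_cst.
  apply: (continuous_comp (f := fun t => - beta i * (T - t)));
    last exact: continuous_expR.
  apply: cvgM; first exact: cvg_cst.
  by apply: cvgB; [exact: cvg_cst|exact: cvg_id].
- by rewrite rec_gain0; exact: cst_continuous.
- by rewrite rec_gain0.
(* The gain of the last lock is constant, so its threshold is [T] or 0 according to its sign. *)
- rewrite rec_gain0 /=; case: ltP => cnu; split; rewrite ?lexx ?T_ge0 ?ltxx//.
  + by move=> t _; rewrite subr_gt0.
  + by move=> t; rewrite leNgt andNb.
  + by rewrite subr_le0.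
- move=> t /andP[t0 tT]; rewrite rec_gain0 /=; case: ifP => _; last first.
    by rewrite /stop_value ltNge t0.
  rewrite (stop_valueE _ _ (discounted_cst_primitive _ _)); last exact: cst_continuous.
  rewrite min_l//.
  have E : expR (beta i * t) * expR (- beta i * t) = 1.
    by rewrite -expRD mulNr subrr expR0.
  have -> : - beta i * (T - t) = beta i * t + (- beta i * T) by ring.
  rewrite expRD -[X in _ * (X - _) = _]E; ring.
- by rewrite [upsilon_rec i j.+1]UE; exact/stop_value_continuous/cGS.
- exact: cGS.
- by move=> s t s0 st tT; rewrite lerD2r lerD2l; exact: Uanti.
- have := is_threshold_inf T T_ge0 _ (cGS _ cU); congr is_threshold.
  by congr inf_or_deadline; apply/seteqP; split=> t /=; rewrite subr_le0.
- by [].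
Qed.

(** * Net gains and best-response thresholds *)

Lemma eta_gt0 theta i k s : 0 < eta theta i k s.
Proof. by rewrite /Defs.eta; case: ifP => _; rewrite ?expR_gt0 ?ltr01. Qed.

Lemma eta_anti theta i k s t : s <= t -> eta theta i k t <= eta theta i k s.
Proof.
move=> st; rewrite /Defs.eta; case: ifP => // _; rewrite ler_expR lerN2.
by apply: ler_sum => m _; rewrite ler_pM2l// le_min !ge_min st lexx ?orbT.
Qed.

Lemma eta_continuous theta i k : continuous (eta theta i k).
Proof.
case k0: (k == ord0); last first.
  have -> : eta theta i k = fun=> 1 by apply/funext => s; rewrite /Defs.eta k0.
  exact: cst_continuous.
pose f s := - \sum_(m < n | m != i) beta m * Num.min s (theta m ord0).
have -> : eta theta i k = expR \o f by apply/funext => s; rewrite /Defs.eta k0.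
move=> x; apply: (continuous_comp (f := f)); last exact: continuous_expR.
apply: cvgN; apply: cvg_big => [|m _]; first exact: add_continuous.
apply: cvgM; first exact: cvg_cst.
by apply: continuous_min; [exact: cvg_id|exact: cvg_cst].
Qed.

Lemma Upsilon_next_continuous i k : continuous (upsilon_next i k).
Proof.
rewrite /Upsilon_next; case: (k < M)%N; last exact: cst_continuous.
by have [] := Upsilon_rec_spec i (M - k.+1).
Qed.

Lemma Upsilon_next_anti i k s t : 0 <= s -> s <= t -> t <= T ->
  upsilon_next i k t <= upsilon_next i k s.
Proof.
rewrite /Upsilon_next; case: ifP => // _.
by have [_ + _ _] := Upsilon_rec_spec i (M - k.+1); apply.
Qed.

Lemma net_gain_continuous theta i k : continuous (net_gain theta i k).
Proof.
move=> x; apply: cvgB; last exact: cvg_cst.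
apply: cvgM; last exact: eta_continuous.
by apply: cvgD; [exact: cvg_cst|exact: Upsilon_next_continuous].
Qed.

(** If the gross reward at [t] is nonpositive, the net gain is too since [nu] is positive. Otherwise
    reward and success probability can only have been larger at [s]. *)
Lemma net_gain_stays_nonpositive theta i k :
  stays_nonpositive T (net_gain theta i k).
Proof.
move=> s t s0 st tT; rewrite !subr_le0.
have [g0 _|g0] := leP (c i k + upsilon_next i k t) 0.
  by apply: le_trans (ltW nu_gt0); rewrite pmulr_lle0 ?eta_gt0.
apply: le_trans.
apply: (@le_trans _ _ ((c i k + upsilon_next i k t) * eta theta i k s)).
  by rewrite ler_wpM2l ?(ltW g0)// eta_anti.
by rewrite ler_pM2r ?eta_gt0// lerD2l Upsilon_next_anti.
Qed.

(** The best response to the first-lock thresholds of the other agents; agent i's own thresholds do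
    not enter [net_gain]. *)
Definition best theta i k : R :=
  inf_or_deadline T [set t | 0 <= t <= T /\ net_gain theta i k t <= 0].

Lemma best_is_threshold theta i k : is_threshold T (net_gain theta i k) (best theta i k).
Proof. exact/is_threshold_inf/net_gain_continuous. Qed.

Lemma bestP theta i k th :
  is_threshold T (net_gain theta i k) th <-> th = best theta i k.
Proof. exact/is_thresholdP/net_gain_continuous. Qed.

Lemma net_gain_later theta i k : k != ord0 ->
  net_gain theta i k = rec_gain i (M - k).
Proof.
move=> k0; apply/funext => s; rewrite /Defs.net_gain /Defs.eta (negbTE k0) mulr1.
have kM : (k <= M)%N by rewrite -ltnS.
rewrite /rec_gain subKn// inord_val /Upsilon_next; congr (_ + _ - _).
case: ltnP => kM'; first by rewrite -(subnSK kM').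
by have -> : (M - k)%N = 0%N by apply/eqP; rewrite subn_eq0.
Qed.

Lemma best_later theta i k : k != ord0 ->
  best theta i k = later_threshold T nu beta c i k.
Proof.
move=> k0; apply/esym/bestP; rewrite net_gain_later//.
by have [] := Upsilon_rec_spec i (M - k).
Qed.

Definition optimal theta i k : R -> R :=
  stop_value (beta i) (best theta i k) (net_gain theta i k).

Lemma Upsilon_nextE theta i k t : (k < M)%N -> 0 <= t <= T ->
  upsilon_next i k t = optimal theta i (inord k.+1) t.
Proof.
move=> kM tT; rewrite /Upsilon_next kM.
have k0 : (inord k.+1 : 'I_M.+1) != ord0 by rewrite -val_eqE /= inordK.
rewrite /optimal best_later// net_gain_later// /later_threshold inordK//.
by have [_ _ _ ->] := Upsilon_rec_spec i (M - k.+1).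
Qed.

Lemma equilibrium_equationsP theta :
  equilibrium_equations T nu beta c theta <->
  forall i k, theta i k = best theta i k.
Proof.
have E i : Num.min (inf_or_deadline T [set t | 0 <= t <= T /\
      (upsilon_next i ord0 t + c i ord0) *
      expR (- \sum_(m < n | m != i) beta m * Num.min t (theta m ord0)) <= nu]) T =
    best theta i ord0.
  have [/andP[_ bT] _ _] := best_is_threshold theta i ord0.
  rewrite -[RHS](min_l bT); congr (Num.min (inf_or_deadline T _) T).
  by apply/seteqP; split=> t /=; rewrite subr_le0 addrC.
split=> [[later first] i k|eq_best].
  have [->|k0] := eqVneq k ord0; first by rewrite [LHS]first E.
  by rewrite best_later// later.
by split=> [i k k0|i]; [rewrite eq_best best_later|rewrite E -eq_best].
Qed.

(** * Utilities as nested stopping values, and their maximum *)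

Definition attempt theta i k (W : R -> R) s : R :=
  (c i k + W s) * eta theta i k s - nu.

(** The value of the actual play of the listed locks, in the nested form of the recursion, to be
    compared with [Upsilon_next]. *)
Definition continuation theta i : seq nat -> R -> R :=
  foldr (fun a W => stop_value (beta i) (theta i (inord a))
                      (attempt theta i (inord a) W)) (fun=> 0).

Lemma attempt_continuous theta i k W :
  continuous W -> continuous (attempt theta i k W).
Proof.
move=> cW x; apply: cvgB; last exact: cvg_cst.
apply: cvgM; last exact: eta_continuous.
by apply: cvgD; [exact: cvg_cst|exact: cW].
Qed.

Lemma continuation_continuous theta i ks : continuous (continuation theta i ks).
Proof.
case: ks => [|k ks] /=; first exact: cst_continuous.
elim: ks k => [|k' ks IH] k /=; apply/stop_value_continuous/attempt_continuous => //.
exact: cst_continuous.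
Qed.

(** All terms but the first share the outer integral over the acquisition of lock [a]. By linearity
    the sum moves inside, where it is the same sum started at the next lock. *)
Lemma sum_continuation theta i l a t :
  \sum_(k < l) foldr (fun j : nat => acquire beta theta i (inord j))
      (reward nu beta c theta i (inord (a + k))) (iota a k) t =
  continuation theta i (iota a l) t.
Proof.
pose iter a m := foldr (fun j : nat => acquire beta theta i (inord j))
  (reward nu beta c theta i (inord (a + m))) (iota a m).
have c_eta (W : R -> R) k : continuous W -> continuous (fun s => W s * eta theta i k s).
  by move=> cW x; apply: cvgM; [exact: cW|exact: eta_continuous].
have c_gain k : continuous (fun s => c i k * eta theta i k s - nu).
  move=> x; apply: cvgB; last exact: cvg_cst.
  by apply: c_eta; exact: cst_continuous.
have iterS b m : iter b m.+1 = acquire beta theta i (inord b) (iter b.+1 m).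
  by rewrite /iter /= addSnnS.
have c_iter b m : continuous (iter b m).
  elim: m b => [|m IH] b; first exact/stop_value_continuous/c_gain.
  by rewrite iterS; apply: stop_value_continuous; exact: c_eta.
suff sum_iter : \sum_(k < l) iter a k t = continuation theta i (iota a l) t by [].
elim: l a t => [|l IH] a t; first by rewrite big_ord0.
rewrite big_ord_recl.
under eq_bigr => k _ do rewrite lift0 iterS.
have -> : iter a (ord0 : 'I_l.+1) = reward nu beta c theta i (inord a).
  by rewrite /iter /= addn0.
pose F (m : nat) s := iter a.+1 m s * eta theta i (inord a) s.
have cF m : continuous (F m) by exact: c_eta.
rewrite -(stop_value_sum _ _ F)// -stop_valueD//; last exact: continuous_ord_sum.
have -> : continuation theta i (iota a l.+1) = stop_value (beta i)
  (theta i (inord a)) (attempt theta i (inord a) (continuation theta i (iota a.+1 l))).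
  by [].
apply: eq_stop_value => s _; rewrite /attempt -IH -mulr_suml.
by rewrite mulrDl; ring.
Qed.

Lemma utilityE theta i :
  utility nu beta c theta i = continuation theta i (iota 0 M.+1) 0.
Proof.
rewrite -sum_continuation; apply: eq_bigr => k _.
by rewrite /expected_reward inord_val.
Qed.

(** Two improvements: the continuation value is raised to the optimal one, then the threshold is
    moved to the best response. *)
Lemma stop_attempt_le theta i k W t : admissible T (theta i) -> continuous W ->
  (forall s, 0 <= s <= T -> W s <= upsilon_next i k s) -> 0 <= t ->
  stop_value (beta i) (theta i k) (attempt theta i k W) t <= optimal theta i k t.
Proof.
move=> adm cW WU t0; have /andP[th0 thT] := adm k.
apply: (@le_trans _ _ (stop_value (beta i) (theta i k) (net_gain theta i k) t)).
  apply: le_stop_value => //; [exact: attempt_continuous|exact: net_gain_continuous|].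
  move=> s /andP[ts sth]; rewrite lerD2r ler_pM2r ?eta_gt0// lerD2l WU//.
  by rewrite (le_trans t0 (ltW ts)) (le_trans (ltW sth) thT).
have Gth := best_is_threshold theta i k; have [_ Gpos _] := Gth.
apply: stop_value_max thT Gpos _ => //; first exact: net_gain_continuous.
by move=> s; apply: is_threshold_le0 Gth; exact: net_gain_stays_nonpositive.
Qed.

(** Peels off one lock; [iota k.+1 (M - k)] lists the locks after [k]. *)
Lemma iota_continuation theta i k : (k < M)%N ->
  continuation theta i (iota k.+1 (M - k)) =
  stop_value (beta i) (theta i (inord k.+1)) (attempt theta i (inord k.+1)
    (continuation theta i (iota (inord k.+1 : 'I_M.+1).+1
       (M - (inord k.+1 : 'I_M.+1))))).
Proof. by move=> kM; rewrite inordK// -(subnSK kM). Qed.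

Lemma continuation_le theta i k t : admissible T (theta i) -> 0 <= t <= T ->
  continuation theta i (iota k.+1 (M - k)) t <= upsilon_next i k t.
Proof.
move=> adm; move El: (M - k)%N => l; elim: l k El t => [|l IH] k El t tT.
  by rewrite /Upsilon_next ltnNge -subn_eq0 El.
have kM : (k < M)%N by rewrite -subn_gt0 El.
rewrite -El iota_continuation// (Upsilon_nextE theta)//; have /andP[t0 _] := tT.
apply: stop_attempt_le => //; first exact: continuation_continuous.
have Ek : (M - (inord k.+1 : 'I_M.+1))%N = l by rewrite inordK// subnS El.
by move=> s sT; rewrite Ek; exact: IH.
Qed.

(** The bound depends on the other agents only, so it holds for all strategies of agent i at
    once. *)
Lemma utility_le theta i : admissible T (theta i) ->
  utility nu beta c theta i <= optimal theta i ord0 0.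
Proof.
move=> adm; rewrite utilityE /=.
have -> : inord 0 = ord0 :> 'I_M.+1 by apply/val_inj; rewrite /= inordK.
apply: stop_attempt_le => // [|s sT]; first exact: continuation_continuous.
by have := continuation_le theta i ord0 s adm sT; rewrite subn0.
Qed.

Lemma continuation_best theta i k t : (forall k, theta i k = best theta i k) ->
  0 <= t <= T ->
  continuation theta i (iota k.+1 (M - k)) t = upsilon_next i k t.
Proof.
move=> eq_best; move El: (M - k)%N => l; elim: l k El t => [|l IH] k El t tT.
  by rewrite /Upsilon_next ltnNge -subn_eq0 El.
have kM : (k < M)%N by rewrite -subn_gt0 El.
rewrite -El iota_continuation// (Upsilon_nextE theta)//; have /andP[t0 _] := tT.
rewrite /optimal -eq_best; apply: eq_stop_value => s /andP[ts sth].
have Ek : (M - (inord k.+1 : 'I_M.+1))%N = l by rewrite inordK// subnS El.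
rewrite /attempt Ek IH// (le_trans t0 ts) (le_trans sth)// eq_best.
by have [/andP[]] := best_is_threshold theta i (inord k.+1).
Qed.

Lemma utility_best theta i : (forall k, theta i k = best theta i k) ->
  utility nu beta c theta i = optimal theta i ord0 0.
Proof.
move=> eq_best; rewrite utilityE /=.
have -> : inord 0 = ord0 :> 'I_M.+1 by apply/val_inj; rewrite /= inordK.
rewrite /optimal -eq_best; apply: eq_stop_value => s /andP[s0 sth].
have sT : 0 <= s <= T.
  rewrite s0 (le_trans sth)// eq_best.
  by have [/andP[]] := best_is_threshold theta i ord0.
by rewrite /attempt /Defs.net_gain -(continuation_best _ _ ord0 s eq_best sT) subn0.
Qed.

(** * Dependence on the thresholds of the other agents *)

Lemma eq_net_gain {theta theta' i k} a t :
  (forall m, m != i -> Num.min a (theta m ord0) = Num.min a (theta' m ord0)) ->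
  t <= a -> net_gain theta i k t = net_gain theta' i k t.
Proof.
move=> E ta; rewrite /Defs.net_gain /Defs.eta; case: ifP => // _.
congr (_ * expR (- _) - nu); apply: eq_bigr => m mi.
by rewrite -(min_idPl ta) -!minA E.
Qed.

(** Up to time [a] the net gain sees the others only through their thresholds truncated at [a], and
    a threshold is determined by the gains up to it. *)
Lemma best_local {theta theta' i k} a :
  (forall m, m != i -> Num.min a (theta m ord0) = Num.min a (theta' m ord0)) ->
  best theta i k <= a -> best theta i k = best theta' i k.
Proof.
move=> E ba; apply/bestP; apply: eq_is_threshold (best_is_threshold theta i k).
by move=> t /andP[_ tb]; apply: eq_net_gain E _; exact: le_trans tb ba.
Qed.

Lemma best_local_ge {theta theta' i k} a :
  (forall m, m != i -> Num.min a (theta m ord0) = Num.min a (theta' m ord0)) ->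
  a <= best theta i k -> a <= best theta' i k.
Proof.
move=> E; apply: is_threshold_ge (best_is_threshold theta i k)
  (best_is_threshold theta' i k).
by move=> t /andP[_ /ltW]; exact: eq_net_gain.
Qed.

Lemma best_others {theta theta' i} k :
  (forall m, m != i -> theta m ord0 = theta' m ord0) ->
  best theta i k = best theta' i k.
Proof. by move=> E; apply: (best_local (best theta i k)) => // m /E ->. Qed.

Lemma optimal_others {theta theta' i} k s :
  (forall m, m != i -> theta m ord0 = theta' m ord0) ->
  optimal theta i k s = optimal theta' i k s.
Proof.
move=> E; rewrite /optimal (best_others k E); apply: eq_stop_value => t _.
by apply: (eq_net_gain t) => // m /E ->.
Qed.

(** * Nash equilibria and fixed points of [best] *)

Lemma best_admissible theta i : admissible T (best theta i).
Proof. by move=> k; have [] := best_is_threshold theta i k. Qed.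

Lemma fixed_nash theta : (forall i k, theta i k = best theta i k) ->
  nash T nu beta c theta.
Proof.
move=> eq_best; split=> [i k|i sigma adm].
  by rewrite eq_best; exact: best_admissible.
rewrite (utility_best theta i (eq_best i)).
apply: le_trans (utility_le _ _ _) _; first by rewrite /= eqxx.
by rewrite le_eqVlt (@optimal_others _ theta) ?eqxx// => m /= /negbTE ->.
Qed.

(** Deviating to [best theta i] attains the bound of [utility_le], so the equilibrium must attain it
    as well. *)
Lemma nash_utility theta i : nash T nu beta c theta ->
  utility nu beta c theta i = optimal theta i ord0 0.
Proof.
move=> [adm opt]; apply/eqP; rewrite eq_le utility_le//=.
have := opt i _ (best_admissible theta i).
have E m : m != i -> [eta theta with i |-> best theta i] m ord0 = theta m ord0.
  by move=> /= /negbTE ->.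
rewrite utility_best ?(optimal_others _ _ E)// => k /=.
by rewrite eqxx (best_others _ E).
Qed.

(** The equality case of [stop_attempt_le] at time 0. The last conclusion hands the equality on to
    the next lock. *)
Lemma optimal_attempt theta i k : admissible T (theta i) ->
  stop_value (beta i) (theta i k)
    (attempt theta i k (continuation theta i (iota k.+1 (M - k)))) 0 =
    optimal theta i k 0 ->
  [/\ best theta i k <= theta i k,
      forall s, best theta i k <= s < theta i k -> net_gain theta i k s = 0 &
      0 < theta i k ->
        continuation theta i (iota k.+1 (M - k)) 0 = upsilon_next i k 0].
Proof.
move=> adm E; have Gth := best_is_threshold theta i k.
have [b0T Gpos _] := Gth.
have cW := continuation_continuous theta i (iota k.+1 (M - k)).
have Gneg s : best theta i k <= s < T -> net_gain theta i k s <= 0.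
  by apply: is_threshold_le0 Gth; exact: net_gain_stays_nonpositive.
have FG s : 0 <= s < T ->
    attempt theta i k (continuation theta i (iota k.+1 (M - k))) s <=
    net_gain theta i k s.
  case/andP=> s0 sT.
  by rewrite lerD2r ler_pM2r ?eta_gt0// lerD2l continuation_le// s0 ltW.
have [ble indiff W0] := stop_value_max_eq _ (beta_gt0 i) _ _ _ _ T
  (attempt_continuous _ _ _ _ cW) (net_gain_continuous _ _ _) (adm k) b0T Gpos Gneg FG E.
by split=> // /W0/addIr/(mulIf (lt0r_neq0 (eta_gt0 _ _ _ _)))/addrI.
Qed.

(** Optimality of the utility is equality at the first lock. It passes from lock to lock as long as
    the thresholds are positive, which is what reachability provides. *)
Lemma nash_best theta i k : nash T nu beta c theta -> reachable theta i k ->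
  best theta i k <= theta i k /\
  forall s, best theta i k <= s < theta i k -> net_gain theta i k s = 0.
Proof.
move=> nash_theta; have [adm _] := nash_theta.
suff E m : (m <= M)%N -> reachable theta i (inord m) ->
    stop_value (beta i) (theta i (inord m)) (attempt theta i (inord m)
      (continuation theta i (iota (inord m : 'I_M.+1).+1
         (M - (inord m : 'I_M.+1))))) 0 =
    optimal theta i (inord m) 0.
  move=> reach; have := E k; rewrite -ltnS ltn_ord inord_val.
  by move=> /(_ isT reach)/(optimal_attempt _ _ _ (adm i))[].
elim: m => [|m IH] mM reach.
  have E0 : inord 0 = ord0 :> 'I_M.+1 by apply/val_inj; rewrite /= inordK.
  have := nash_utility _ i nash_theta.
  by rewrite utilityE /= E0 subn0.
have Em : (inord m : 'I_M.+1) = m :> nat by rewrite inordK// ltnS ltnW.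
have reach_m : reachable theta i (inord m).
  move=> j; rewrite Em => jm; apply: reach; rewrite inordK//.
  exact: ltnW.
have [_ _] := optimal_attempt _ _ _ (adm i) (IH (ltnW mM) reach_m).
have m_pos : 0 < theta i (inord m) by apply: reach; rewrite Em inordK.
rewrite iota_continuation Em// (Upsilon_nextE theta) ?Em ?lexx//.
exact.
Qed.

Lemma eta_lt theta i m s t : m != i -> s < t -> s < theta m ord0 ->
  eta theta i ord0 t < eta theta i ord0 s.
Proof.
move=> mi st sm; rewrite /Defs.eta eqxx ltr_expR ltrN2.
rewrite (bigD1 m)//= [ltRHS](bigD1 m)//=; apply: ltr_leD.
  by rewrite ltr_pM2l// (min_idPl (ltW sm)) lt_min st.
by apply: ler_sum => j _; rewrite ler_pM2l// le_min !ge_min (ltW st) lexx ?orbT.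
Qed.

(* An agent who is indifferent on an interval faces a constant success
   probability there, so every other agent has already stopped. *)
Lemma indifferent_last theta i m : nash T nu beta c theta ->
  best theta i ord0 < theta i ord0 -> m != i ->
  theta m ord0 <= best theta i ord0.
Proof.
move=> nash_theta; set b := best _ _ _ => bi mi; rewrite leNgt; apply/negP => bm.
have [adm _] := nash_theta.
have [|_ indiff] := nash_best theta i ord0 nash_theta; first by move=> j.
(* Between [b] and [x] agent i is indifferent while agent m is active. From [b] to the midpoint the
   reward does not rise and the success probability drops strictly, yet both products equal [nu]. *)
pose x := Num.min (theta i ord0) (theta m ord0).
have bx : b < x by rewrite lt_min bi bm.
have xi : x <= theta i ord0 by rewrite ge_min lexx.
have bs : b < (b + x) / 2 by lra.
have si : (b + x) / 2 < theta i ord0 by lra.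
have /andP[b0 _] := best_admissible theta i ord0.
have /andP[_ iT] := adm i ord0.
have Eb : (c i ord0 + upsilon_next i ord0 b) * eta theta i ord0 b = nu.
  by apply/subr0_eq/indiff; rewrite lexx bi.
have Es : (c i ord0 + upsilon_next i ord0 ((b + x) / 2)) *
    eta theta i ord0 ((b + x) / 2) = nu.
  by apply/subr0_eq/indiff; rewrite (ltW bs) si.
have gs : 0 < c i ord0 + upsilon_next i ord0 ((b + x) / 2).
  by rewrite -(pmulr_lgt0 _ (eta_gt0 theta i ord0 ((b + x) / 2))) Es.
have lt1 : nu < (c i ord0 + upsilon_next i ord0 ((b + x) / 2)) * eta theta i ord0 b.
  by rewrite -[ltLHS]Es ltr_pM2l// (eta_lt _ _ m).
suff le2 : (c i ord0 + upsilon_next i ord0 ((b + x) / 2)) * eta theta i ord0 b <= nu.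
  by have := lt_le_trans lt1 le2; rewrite ltxx.
rewrite -[leRHS]Eb ler_pM2r ?eta_gt0// lerD2l.
by apply: Upsilon_next_anti => //; apply/ltW => //; exact: lt_le_trans si iT.
Qed.

(** An agent m whose threshold exceeds its best response outlasts agent i, so both values for m lie
    beyond the best response of agent i, and truncation there hides the change. *)
Lemma nash_best_fixed theta : nash T nu beta c theta ->
  forall i k, best theta i k = best (best theta) i k.
Proof.
move=> nash_theta i k; have [->|k0] := eqVneq k ord0; last by rewrite !best_later.
have best_le m : best theta m ord0 <= theta m ord0.
  by have [] := nash_best theta m ord0 nash_theta (fun j => _).
apply: (best_local (best theta i ord0)) => // m mi.
have := best_le m; rewrite le_eqVlt => /predU1P[->//|bm].
have im := indifferent_last _ _ _ nash_theta bm; rewrite eq_sym in mi.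
have := le_trans (best_le i) (im _ mi) => bim.
by rewrite !min_l// (le_trans bim)// ltW.
Qed.

(** * Uniqueness and existence of the fixed point *)

Lemma fixed_unique theta theta' :
  (forall i k, theta i k = best theta i k) ->
  (forall i k, theta' i k = best theta' i k) -> theta = theta'.
Proof.
move=> fix1 fix2.
suff E0 i : theta i ord0 = theta' i ord0.
  by apply/funext => i; apply/funext => k; rewrite fix1 fix2; exact: best_others.
apply/eqP; rewrite -[_ == _]negbK; apply/negP => i0.
(* Among the agents on which the profiles differ, [j] has the earliest threshold in either profile.
   Truncated there the profiles agree, so [best_local] makes the two thresholds of [j] equal. *)
pose mins j := Num.min (theta j ord0) (theta' j ord0).
case: (@arg_minP _ _ _ i (fun j => theta j ord0 != theta' j ord0) mins i0).
move=> j jneq jmin.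
have agree m : Num.min (mins j) (theta m ord0) = Num.min (mins j) (theta' m ord0).
  have [->//|/jmin] := eqVneq (theta m ord0) (theta' m ord0).
  by rewrite le_min => /andP[jm jm']; rewrite !min_l.
case/eqP: jneq; rewrite fix1 fix2.
have [le|/ltW le] := leP (theta j ord0) (theta' j ord0).
  by apply: (best_local (mins j)) => //; rewrite -fix1 le_min lexx.
by apply/esym/(best_local (mins j)) => //; rewrite -fix2 le_min lexx le.
Qed.

(* Agents are settled one by one in the order in which they stop: those not yet
   settled count as active until T, and among them the one with the earliest
   best response stops next. *)
Lemma fixed_exists : exists theta, forall i k, theta i k = best theta i k.
Proof.
suff step m : (m <= n)%N -> exists (F : {set 'I_n}) theta, [/\ #|F| = m,
    forall i, i \in F -> theta i ord0 = best theta i ord0,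
    forall i, i \notin F -> theta i ord0 = T &
    forall i j, i \in F -> j \notin F -> theta i ord0 <= best theta j ord0].
  have [F [theta [Fn fixF _ _]]] := step n (leqnn n).
  have /subset_cardP/(_ (subset_predT _)) FT : #|F| = #|'I_n| by rewrite Fn card_ord.
  (* Here [theta] is a fixed point at the first lock only. [best theta] has the same first-lock
     thresholds, and best responses depend on nothing else. *)
  exists (best theta) => i k; apply: best_others => m _.
  by apply: fixF; rewrite FT.
elim: m => [|m IH] mn.
  exists finset.set0, (fun _ _ => T); split=> [|i|//|i j]; rewrite ?cards0 ?finset.inE//.
have [F [theta [Fm fixF outF leF]]] := IH (ltnW mn).
have [j0] : exists j, j \in (~: F)%SET.
  by apply/card_gt0P; rewrite cardsCs finset.setCK card_ord Fm subn_gt0.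
rewrite finset.inE => j0F.
case: (@arg_minP _ _ _ j0 (fun j => j \notin F) (fun j => best theta j ord0) j0F).
move=> j jF jmin; set b := best theta j ord0 in jmin.
pose theta' : profile := fun i k => if i == j then b else theta i k.
(* Lowering the threshold of [j] from [T] to [b] is invisible up to time [b]. *)
have agree i : Num.min b (theta i ord0) = Num.min b (theta' i ord0).
  rewrite /theta'; case: eqP => // ->; rewrite outF// minxx min_l//.
  by have /andP[] := best_admissible theta j ord0.
have agree' i k := @best_local theta theta' i k b (fun m _ => agree m).
have ltF i : i \in F -> theta' i ord0 = theta i ord0.
  by move=> iF; rewrite /theta'; case: eqP => // ij; rewrite -ij iF in jF.
exists (j |: F)%SET, theta'; split.
- by rewrite cardsU1 jF Fm.
- move=> i; rewrite !finset.inE => /orP[/eqP ->|iF].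
    by rewrite {1}/theta' eqxx -agree'.
  by rewrite ltF// -agree' -fixF// leF.
- by move=> i; rewrite !finset.inE negb_or /theta' => /andP[/negbTE -> /outF].
- move=> i l; rewrite !finset.inE negb_or => /orP[/eqP ->|iF] /andP[lj lF].
    rewrite {1}/theta' eqxx; apply: best_local_ge (fun m _ => agree m) _.
    exact: jmin.
  rewrite ltF//; apply: (@le_trans _ _ b); first exact: leF.
  by apply: best_local_ge (fun m _ => agree m) _; exact: jmin.
Qed.

(** * Nash equilibria compared with the fixed point *)

Lemma nash_agree thetas theta : (forall i k, thetas i k = best thetas i k) ->
  nash T nu beta c theta -> thetas = best theta.
Proof. by move=> fixs nash_theta; exact: fixed_unique (nash_best_fixed _ nash_theta). Qed.

(** Induction over the locks: agreement at the earlier locks makes lock k reachable in [theta], and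
    a larger threshold there would give an interval of indifference, which genericity excludes once
    the net gains of the two profiles are identified. *)
Lemma nash_generic thetas theta : (forall i k, thetas i k = best thetas i k) ->
  generic_profile T nu beta c thetas -> nash T nu beta c theta -> thetas = theta.
Proof.
move=> fixs [reach no_indiff] nash_theta.
have E := nash_agree _ _ fixs nash_theta; have [adm _] := nash_theta.
have best_le j : thetas j ord0 <= theta j ord0.
  by rewrite E; have [] := nash_best theta j ord0 nash_theta.
suff eq_m m i : (m <= M)%N -> thetas i (inord m) = theta i (inord m).
  apply/funext => i; apply/funext => k.
  by have := eq_m k i; rewrite -ltnS ltn_ord inord_val; exact.
elim/ltn_ind: m => m IH mM; set k := inord m.
have Ek : k = m :> nat by rewrite inordK.
have [|ble indiff] := nash_best theta i k nash_theta.
  move=> j; rewrite Ek => jm; have := reach i k j; rewrite Ek => /(_ jm).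
  by have := IH j jm; rewrite inord_val => -> //; rewrite -ltnS.
rewrite -E in ble indiff.
move: ble; rewrite le_eqVlt => /predU1P[//|lt_k].
pose s := (thetas i k + theta i k) / 2.
have ks : thetas i k < s by rewrite /s; lra.
have sk : s < theta i k by rewrite /s; lra.
have /andP[_ kT] := adm i k.
have := no_indiff i k s; rewrite ks (lt_le_trans sk kT) => /(_ isT)/eqP[].
rewrite -(indiff s); last by rewrite (ltW ks).
have [k0|k0] := eqVneq k ord0; last by rewrite !net_gain_later.
rewrite k0 in lt_k ks *; apply: (eq_net_gain s) => // m' m'i.
suff -> : thetas m' ord0 = theta m' ord0 by [].
(* Two agents cannot both exceed their best responses: each would have to stop before the best
   response of the other, which is circular. *)
have := best_le m'; rewrite le_eqVlt => /predU1P[//|lt_m'].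
have := indifferent_last theta i m' nash_theta.
have := indifferent_last theta m' i nash_theta.
rewrite -E lt_k lt_m' eq_sym => /(_ isT m'i) le1 /(_ isT m'i) le2.
by have := lt_le_trans lt_m' (le_trans le2 (le_trans (ltW lt_k) le1)); rewrite ltxx.
Qed.

End LockGame.

Theorem theorem7 (R : realType) (n M : nat) (T nu : R) (beta : 'I_n -> R)
    (c : 'I_n -> 'I_M.+1 -> R)
    (T_gt0 : 0 < T) (nu_gt0 : 0 < nu) (beta_gt0 : forall i, 0 < beta i) :
  exists thetas : profile (R := R) (n := n) (M := M),
    [/\ unique (equilibrium_equations T nu beta c) thetas,
        nash T nu beta c thetas,
        (forall theta, nash T nu beta c theta ->
           agree_up_to_indifference T nu beta c thetas theta) &
        (generic_profile T nu beta c thetas ->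
           unique (nash T nu beta c) thetas)].
Proof.
have equationsP := equilibrium_equationsP T nu beta c T_gt0 beta_gt0.
have [thetas fixs] := fixed_exists T nu beta c T_gt0 beta_gt0.
have nash_thetas : nash T nu beta c thetas by exact: fixed_nash.
exists thetas; split=> //.
- split=> [|theta /equationsP fix_theta]; first exact/equationsP.
  exact: fixed_unique fixs fix_theta.
- move=> theta nash_theta i k reach.
  rewrite (nash_agree T nu beta c T_gt0 nu_gt0 beta_gt0 thetas theta)//.
  exact: nash_best.
- move=> generic; split=> // theta nash_theta.
  exact: (nash_generic T nu beta c T_gt0 nu_gt0 beta_gt0).
Qed.
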